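(* Let $\mathfrak{C}$ be a monster model of a complete first-order theory $T$, and let $\bar c$ be a tuple enumerating all elements of $\mathfrak{C}$. Then $S_{\bar c}(\mathfrak{C})$ has a left-continuous semigroup operation extending the natural action of $\mathrm{Aut}(\mathfrak{C})$ on $S_{\bar c}(\mathfrak{C})$ if and only if $T$ is stable.
   Context: A monster model is a model that is $\kappa$-saturated and strongly $\kappa$-homogeneous for a sufficiently large strong limit cardinal $\kappa$. $S_{\bar c}(\mathfrak{C})$ is the space of all complete types $\mathrm{tp}(\bar a/\mathfrak{C})$ with $\bar a\equiv\bar c$ ($\bar a$ taken in a bigger monster model $\mathfrak{C}'\succ\mathfrak{C}$), with the usual compact Hausdorff topology. $\mathrm{Aut}(\mathfrak{C})$ is identified with a (dense) subset of $S_{\bar c}(\mathfrak{C})$ via $\sigma\mapsto\mathrm{tp}(\sigma(\bar c)/\mathfrak{C})$. A semigroup operation $*$ on $S_{\bar c}(\mathfrak{C})$ is left-continuous if for every $q$ the map $p\mapsto p*q$ is continuous; it extends the action of $\mathrm{Aut}(\mathfrak{C})$ if $\mathrm{tp}(\sigma(\bar c)/\mathfrak{C})*q=\sigma(q)$ for all $\sigma\in\mathrm{Aut}(\mathfrak{C})$ and $q\in S_{\bar c}(\mathfrak{C})$. *)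

(* Defs.v *)
From HB Require Import structures.
From mathcomp Require Import all_boot all_order.
From mathcomp Require Import boolp classical_sets functions cardinality.
From mathcomp Require Import topology.

Set Implicit Arguments.
Unset Strict Implicit.
Unset Printing Implicit Defensive.

Local Open Scope classical_set_scope.
Local Open Scope card_scope.

Record language := Language {
  fsym : Type;
  farity : fsym -> nat;
  rsym : Type;
  rarity : rsym -> nat }.

(* [V] is the type of free variables.  Parameters are treated as free variables
   with a prescribed value: a formula in the variables [I] with parameters from
   [B] is an element of [formula L (I + B)]. *)
Inductive term (L : language) (V : Type) : Type :=
| Tvar (v : V)
| Tapp (f : fsym L) (ts : 'I_(farity f) -> term L V).

(* In [Fall phi] the bound variable is [None : option V]. *)
Inductive formula (L : language) (V : Type) : Type :=
| Fbot
| Feq (s t : term L V)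
| Frel (r : rsym L) (ts : 'I_(rarity r) -> term L V)
| Fimp (phi psi : formula L V)
| Fall (phi : formula L (option V)).

Arguments Tvar {L V} v.
Arguments Tapp {L V} f ts.
Arguments Fbot {L V}.
Arguments Feq {L V} s t.
Arguments Frel {L V} r ts.
Arguments Fimp {L V} phi psi.
Arguments Fall {L V} phi.

Definition Fnot (L : language) (V : Type) (phi : formula L V) : formula L V :=
  Fimp phi Fbot.

Fixpoint term_map (L : language) (V W : Type) (h : V -> W) (t : term L V) :
    term L W :=
  match t with
  | Tvar v => Tvar (h v)
  | Tapp f ts => Tapp f (fun i => term_map h (ts i))
  end.

Fixpoint formula_map (L : language) (V W : Type) (h : V -> W)
    (phi : formula L V) : formula L W :=
  match phi with
  | Fbot => Fbot
  | Feq s t => Feq (term_map h s) (term_map h t)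
  | Frel r ts => Frel r (fun i => term_map h (ts i))
  | Fimp phi psi => Fimp (formula_map h phi) (formula_map h psi)
  | Fall phi => Fall (formula_map (omap h) phi)
  end.

Record structure (L : language) := Structure {
  carrier :> Type;
  carrier_inhabited : inhabited carrier;
  finterp : forall f : fsym L, ('I_(farity f) -> carrier) -> carrier;
  rinterp : forall r : rsym L, ('I_(rarity r) -> carrier) -> Prop }.

Fixpoint eval (L : language) (M : structure L) (V : Type) (v : V -> M)
    (t : term L V) : M :=
  match t with
  | Tvar x => v x
  | Tapp f ts => finterp (fun i => eval v (ts i))
  end.

Definition extend (A V : Type) (v : V -> A) (x : A) (o : option V) : A :=
  if o is Some y then v y else x.

Fixpoint sat (L : language) (M : structure L) (V : Type) (phi : formula L V) :
    (V -> M) -> Prop :=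
  match phi with
  | Fbot => fun _ => False
  | Feq s t => fun v => eval v s = eval v t
  | Frel r ts => fun v => rinterp (fun i => eval v (ts i))
  | Fimp phi psi => fun v => sat phi v -> sat psi v
  | Fall phi => fun v => forall x : M, sat phi (extend v x)
  end.

Definition sentence (L : language) := formula L void.

Definition holds (L : language) (M : structure L) (phi : sentence L) : Prop :=
  sat phi (of_void M).

Definition models (L : language) (M : structure L) (T : set (sentence L)) :
    Prop := forall phi, T phi -> holds M phi.

Definition entails (L : language) (T : set (sentence L)) (phi : sentence L) :
    Prop := forall M : structure L, models M T -> holds M phi.

Definition complete_theory (L : language) (T : set (sentence L)) : Prop :=
  (exists M : structure L, models M T) /\
  (forall phi, entails T phi \/ entails T (Fnot phi)).

Definition order_property (L : language) (T : set (sentence L)) (n m : nat)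
    (phi : formula L ('I_n + 'I_m)) : Prop :=
  exists (M : structure L) (a : nat -> 'I_n -> M) (b : nat -> 'I_m -> M),
    models M T /\
    forall i j : nat,
      sat phi (fun z => match z with inl k => a i k | inr k => b j k end)
      <-> (i < j)%N.

Definition stable (L : language) (T : set (sentence L)) : Prop :=
  forall (n m : nat) (phi : formula L ('I_n + 'I_m)), ~ order_property T phi.

Record automorphism (L : language) (M : structure L) := Automorphism {
  aut_fun :> M -> M;
  aut_bij : bijective aut_fun;
  aut_finterp : forall (f : fsym L) (xs : 'I_(farity f) -> M),
    aut_fun (finterp xs) = finterp (fun i => aut_fun (xs i));
  aut_rinterp : forall (r : rsym L) (xs : 'I_(rarity r) -> M),
    rinterp xs <-> rinterp (fun i => aut_fun (xs i)) }.

Record elementary_embedding (L : language) (M N : structure L) :=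
  ElementaryEmbedding {
    emb_fun :> M -> N;
    emb_sat : forall (V : Type) (phi : formula L V) (v : V -> M),
      sat phi v <-> sat phi (fun x => emb_fun (v x)) }.

(* The complete type of the tuple [a] over the empty set. *)
Definition tp0 (L : language) (M : structure L) (I : Type) (a : I -> M) :
    set (formula L I) := [set phi | sat phi a].

Definition with_params (A I B : Type) (a : I -> A) (e : B -> A) (z : I + B) :
    A := match z with inl i => a i | inr b => e b end.

(* The complete type of the tuple [a] over the image of [e]. *)
Definition tp (L : language) (M : structure L) (B I : Type) (e : B -> M)
    (a : I -> M) : set (formula L (I + B)) :=
  [set phi | sat phi (with_params a e)].

(* A cardinal is represented by a type of that cardinality. *)
Definition card_lt (T U : Type) (A : set T) (B : set U) : Prop :=
  A #<= B /\ ~ (B #<= A).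

Definition strong_limit (K : Type) : Prop :=
  forall A : set K, card_lt A [set: K] ->
    card_lt [set B : set K | B `<=` A] [set: K].

Definition saturated (K : Type) (L : language) (M : structure L) : Prop :=
  forall (A : set M) (p : set (formula L (unit + A))),
    card_lt A [set: K] ->
    (forall p0 : set (formula L (unit + A)), p0 `<=` p -> finite_set p0 ->
       exists x : M, p0 `<=` tp (fun a : A => \val a) (fun _ : unit => x)) ->
    exists x : M, p `<=` tp (fun a : A => \val a) (fun _ : unit => x).

Definition strongly_homogeneous (K : Type) (L : language) (M : structure L) :
    Prop :=
  forall (A : set M) (g : A -> M),
    card_lt A [set: K] ->
    tp0 g = tp0 (fun a : A => \val a) ->
    exists sigma : automorphism M, forall a : A, sigma (\val a) = g a.

(* "Sufficiently large" is read as: larger than the number of formulas of the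
   language, that is, than |L| + aleph_0. *)
Definition monster (K : Type) (L : language) (M : structure L) : Prop :=
  [/\ strong_limit K, card_lt [set: formula L nat] [set: K],
      saturated K M & strongly_homogeneous K M].

Record type_space (L : language) (C C' : structure L)
    (j : elementary_embedding C C') (I : Type) (c : I -> C) := TypeSpace {
  tset :> set (formula L (I + C));
  tset_realized : exists a : I -> C',
    tp0 a = tp0 (fun i => j (c i)) /\ tset = tp j a }.

Section TypeSpaceTopology.
Context (L : language) (C C' : structure L) (j : elementary_embedding C C').
Context (I : Type) (c : I -> C).

Definition basic_clopen (phi : formula L (I + C)) : set (type_space j c) :=
  [set p | tset p phi].

HB.instance Definition _ := gen_eqMixin (type_space j c).
HB.instance Definition _ := gen_choiceMixin (type_space j c).
HB.instance Definition _ :=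
  @isSubBaseTopological.Build (type_space j c) (set (type_space j c))
    (range basic_clopen) id.

End TypeSpaceTopology.

Lemma eval_aut (L : language) (M : structure L) (sigma : automorphism M)
  (V : Type) (v : V -> M) (t : term L V) :
  eval (fun x => sigma (v x)) t = sigma (eval v t).
Proof.
elim: t => [x|f ts IH] //=; rewrite aut_finterp; congr finterp.
by apply: funext => i; exact: IH.
Qed.

Lemma sat_aut (L : language) (M : structure L) (sigma : automorphism M)
  (V : Type) (phi : formula L V) (v : V -> M) :
  sat phi (fun x => sigma (v x)) <-> sat phi v.
Proof.
elim: phi v => {V} [V|V s t|V r ts|V phi IH1 psi IH2|V phi IH] v //=.
- by rewrite !eval_aut; split=> [/(bij_inj (aut_bij sigma))//|->].
- rewrite (aut_rinterp sigma (fun i => eval v (ts i))).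
  suff -> : (fun i => eval (fun x => sigma (v x)) (ts i)) =
            (fun i => sigma (eval v (ts i))) by [].
  by apply: funext => i; exact: eval_aut.
- by split=> H /IH1/H/IH2.
- have E x : extend (fun y => sigma (v y)) (sigma x) =
             (fun o => sigma (extend v x o)) by apply: funext => -[].
  split=> H x; first by apply/IH; rewrite -E.
  have [tau _ tauK] := aut_bij sigma.
  by rewrite -(tauK x) E; apply/IH.
Qed.

Lemma aut_type_subproof (L : language) (C C' : structure L)
  (j : elementary_embedding C C') (I : Type) (c : I -> C)
  (sigma : automorphism C) :
  exists a : I -> C', tp0 a = tp0 (fun i => j (c i)) /\
    tp j (fun i => j (sigma (c i))) = tp j a.
Proof.
exists (fun i => j (sigma (c i))); split=> //; apply/seteqP.
split=> phi; rewrite /tp0 /= => H.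
- by apply/(emb_sat j)/(sat_aut sigma)/(emb_sat j).
- by apply/(emb_sat j phi (fun i => sigma (c i)))/sat_aut/(emb_sat j).
Qed.

Definition aut_type (L : language) (C C' : structure L)
    (j : elementary_embedding C C') (I : Type) (c : I -> C)
    (sigma : automorphism C) : type_space j c :=
  TypeSpace (aut_type_subproof j c sigma).

(* sigma(q) = { phi(x, sigma(b)) | phi(x, b) \in q }. *)
Definition aut_act (L : language) (C : structure L) (I : Type)
    (sigma : automorphism C) (q : set (formula L (I + C))) :
    set (formula L (I + C)) :=
  [set formula_map (fun z => match z with
                             | inl i => inl i
                             | inr b => inr (sigma b)
                             end) phi | phi in q].

Definition left_continuous (S : topologicalType) (op : S -> S -> S) : Prop :=
  forall q : S, continuous (fun p => op p q).

Definition extends_aut_action (L : language) (C C' : structure L)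
    (j : elementary_embedding C C') (I : Type) (c : I -> C)
    (op : type_space j c -> type_space j c -> type_space j c) : Prop :=
  forall (sigma : automorphism C) (q : type_space j c),
    tset (op (aut_type j c sigma) q) = aut_act sigma (tset q).

(* Main.v *)
(* If T is stable, every type q over C is definable; for p = tp(f(c)/C), with
   f : C -> C' elementary, one lets p * q be the restriction to C of the type over
   C' defined by the image under f of the defining scheme of q. So phi(x, e) is in
   p * q if and only if d_q phi is in p, a clopen condition on p, and
   associativity is a computation with defining schemes.

   Conversely, let phi have the order property, witnessed in C by sequences
   (a_k), (b_l) of constant type, say a_k = tau_k(a_0) and b_l = sigma_l(b_0). Let
   q and p be limits of the types of tau_k(c) and of sigma_l^-1(c) along an
   ultrafilter. Since sigma_l^-1 * q contains the negation of phi(x, b_0) for all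
   l, so would r * q for all r near p. But saturation produces rho arbitrarily
   close to p with phi(a_k, rho^-1(b_0)) for all k, so that phi(x, b_0) is in
   rho * q. *)
Require Import Defs.
From mathcomp Require Import all_boot all_order.
From mathcomp Require Import boolp classical_sets functions cardinality.
From mathcomp Require Import topology.

Set Implicit Arguments.
Unset Strict Implicit.
Unset Printing Implicit Defensive.

Local Open Scope classical_set_scope.

(** * Syntax *)

Definition Ftrue (L : language) (V : Type) : formula L V := Fnot Fbot.

Arguments Ftrue {L V}.

Definition Fand (L : language) (V : Type) (phi psi : formula L V) :
  formula L V := Fnot (Fimp phi (Fnot psi)).

Fixpoint Fconj (L : language) (V : Type) (f : nat -> formula L V) (n : nat) :
    formula L V :=
  if n is n'.+1 then Fand (Fconj f n') (f n') else Ftrue.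

Lemma sat_true (L : language) (M : structure L) (V : Type) (v : V -> M) :
  sat Ftrue v.
Proof. exact: id. Qed.

Lemma sat_not (L : language) (M : structure L) (V : Type) (phi : formula L V)
  (v : V -> M) : sat (Fnot phi) v <-> ~ sat phi v.
Proof. by []. Qed.

Lemma sat_all (L : language) (M : structure L) (V : Type)
  (phi : formula L (option V)) (v : V -> M) :
  sat (Fall phi) v <-> forall x, sat phi (extend v x).
Proof. by []. Qed.

Lemma sat_and (L : language) (M : structure L) (V : Type)
  (phi psi : formula L V) (v : V -> M) :
  sat (Fand phi psi) v <-> sat phi v /\ sat psi v.
Proof.
split=> /= [H|[Hphi Hpsi]]; last by apply.
by split; apply: contrapT => Hn; apply: H => // _.
Qed.

Lemma sat_conj (L : language) (M : structure L) (V : Type)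
  (f : nat -> formula L V) (n : nat) (v : V -> M) :
  sat (Fconj f n) v <-> forall k, (k < n)%N -> sat (f k) v.
Proof.
elim: n => [|n IH]; first by split=> // _; apply.
rewrite [Fconj _ _]/= sat_and IH; split=> [[H1 H2] k|H].
  by rewrite ltnS leq_eqVlt => /orP[/eqP->|/H1].
by split=> [k kn|]; apply: H; rewrite // ltnS ltnW.
Qed.

Lemma eval_map (L : language) (M : structure L) (V W : Type) (h : V -> W)
  (t : term L V) (w : W -> M) :
  Defs.eval w (term_map h t) = Defs.eval (fun x => w (h x)) t.
Proof.
elim: t => //= f ts IH; congr finterp.
by apply: funext => i; exact: IH.
Qed.

Lemma sat_map (L : language) (M : structure L) (V W : Type) (h : V -> W)
  (phi : formula L V) (w : W -> M) :
  sat (formula_map h phi) w <-> sat phi (fun x => w (h x)).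
Proof.
elim: phi W h w => {V} [V|V s t|V r ts|V phi IH1 psi IH2|V phi IH] W h w //=.
- by rewrite !eval_map.
- suff -> : (fun i => Defs.eval w (term_map h (ts i))) =
            (fun i => Defs.eval (fun x => w (h x)) (ts i)) by [].
  by apply: funext => i; rewrite eval_map.
- by rewrite IH1 IH2.
- have E x : (fun o => extend w x (omap h o)) = extend (fun y => w (h y)) x.
    by apply: funext => -[].
  by split=> H x; have := H x; rewrite IH E.
Qed.

Lemma term_map_comp (L : language) (U V W : Type) (g : V -> W) (h : U -> V)
  (t : term L U) : term_map g (term_map h t) = term_map (g \o h) t.
Proof.
by elim: t => //= f ts IH; congr Tapp; apply: funext => i; exact: IH.
Qed.

Lemma formula_map_comp (L : language) (U V W : Type) (g : V -> W) (h : U -> V)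
  (phi : formula L U) :
  formula_map g (formula_map h phi) = formula_map (g \o h) phi.
Proof.
elim: phi V W g h => {U} [U|U s t|U r ts|U phi IH1 psi IH2|U phi IH] V W g h //=.
- by rewrite !term_map_comp.
- by congr Frel; apply: funext => i; rewrite term_map_comp.
- by rewrite IH1 IH2.
- by rewrite IH; congr (Fall (formula_map _ _)); apply: funext => -[].
Qed.

Lemma formula_map_id (L : language) (V : Type) (phi : formula L V) :
  formula_map id phi = phi.
Proof.
have tid W (t : term L W) : term_map id t = t.
  by elim: t => //= f ts IH; congr Tapp; apply: funext => i; exact: IH.
elim: phi => {V} [V|V s t|V r ts|V phi IH1 psi IH2|V phi IH] //=.
- by rewrite !tid.
- by congr Frel; apply: funext => i; rewrite tid.
- by rewrite IH1 IH2.
- by rewrite -[in RHS]IH; congr (Fall (formula_map _ _)); apply: funext => -[].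
Qed.

Lemma sat_congr (L : language) (M : structure L) (V : Type)
  (phi : formula L V) (v w : V -> M) : v =1 w -> sat phi v -> sat phi w.
Proof. by move=> /funext->. Qed.

Lemma term_support (L : language) (V : Type) (t : term L V) :
  exists s : seq {classic V}, forall (M : structure L) (v w : V -> M),
    (forall x : {classic V}, x \in s -> v x = w x) ->
    Defs.eval v t = Defs.eval w t.
Proof.
elim: t => [x|f ts /choice[s Hs]].
  by exists [:: (x : {classic V})] => M v w /(_ x); rewrite inE eqxx; apply.
exists (flatten [seq s i | i <- enum 'I_(farity f)]) => M v w H /=.
congr finterp; apply: funext => i; apply: Hs => x xs; apply: H.
by apply/flattenP; exists (s i) => //; apply: map_f; rewrite mem_enum.
Qed.

Lemma formula_support (L : language) (V : Type) (phi : formula L V) :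
  exists s : seq {classic V}, forall (M : structure L) (v w : V -> M),
    (forall x : {classic V}, x \in s -> v x = w x) -> sat phi v -> sat phi w.
Proof.
elim: phi => {V} [V|V t u|V r ts|V phi [s Hs] psi [s' Hs']|V phi [s Hs]].
- by exists [::].
- have [s Hs] := term_support t; have [s' Hs'] := term_support u.
  exists (s ++ s') => M v w H /=.
  rewrite -(Hs _ v w) -1?(Hs' _ v w)// => x xs; apply: H.
    by rewrite mem_cat xs orbT.
  by rewrite mem_cat xs.
- have /choice[s Hs] i := term_support (ts i).
  exists (flatten [seq s i | i <- enum 'I_(rarity r)]) => M v w H /=.
  suff -> : (fun i => Defs.eval v (ts i)) = (fun i => Defs.eval w (ts i)) by [].
  apply: funext => i; apply: Hs => x xs; apply: H.
  by apply/flattenP; exists (s i) => //; apply: map_f; rewrite mem_enum.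
- exists (s ++ s') => M v w H /= Hv Hw; apply: (Hs' M v).
    by move=> x xs; apply: H; rewrite mem_cat xs orbT.
  apply: Hv; apply: Hs Hw => x xs; apply/esym/H.
  by rewrite mem_cat xs.
- pose f (o : {classic (option V)}) : option {classic V} := o.
  exists (pmap f s) => M v w H /= Hv x.
  apply: Hs (Hv x) => -[y ys|_ //] /=; apply: H.
  by rewrite mem_pmap; apply/mapP; exists (Some y).
Qed.

(* The variables in [P] are quantified although [chi] is still a formula over
   [V]; its value just does not depend on them. *)
Lemma formula_forall (L : language) (V : Type) (P : set V)
  (phi : formula L V) :
  exists chi : formula L V, forall (M : structure L) (v : V -> M),
    sat chi v <->
    forall w : V -> M, (forall x, ~ P x -> w x = v x) -> sat phi w.
Proof.
have [s Hs] := formula_support phi.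
suff [chi Hchi] : exists chi : formula L V, forall (M : structure L) v,
    sat chi v <-> forall w : V -> M,
      (forall x : {classic V}, ~ (x \in s /\ P x) -> w x = v x) -> sat phi w.
  exists chi => M v; rewrite Hchi; split=> H w Hw.
    pose w' (x : V) := if (x : {classic V}) \in s then w x else v x.
    apply: (Hs _ w'); first by move=> x; rewrite /w' => ->.
    apply: H => x; rewrite /w'; case: ifP => // xs nP.
    by apply: Hw => Px; apply: nP.
  by apply: H => x nP; apply: Hw => -[_ /nP].
elim: s {Hs} => [|x s [chi Hchi]].
  exists phi => M v; split=> [H w|]; last by apply.
  by move=> Hw; apply: sat_congr H => x; rewrite Hw// => -[].
have [Px|nPx] := pselect (P x); last first.
  exists chi => M v; rewrite Hchi; split=> H w Hw; apply: H => y ny; apply: Hw.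
    move=> [+ Py]; rewrite inE => /orP[/eqP yx|ys]; last exact: ny.
    by apply: nPx; rewrite -yx.
  by move=> [ys Py]; apply: ny; rewrite inE ys orbT.
pose h (y : {classic V}) : option V := if y == x then None else Some y.
exists (Fall (formula_map h chi)) => M v; rewrite sat_all.
split=> [H w Hw|H a].
  move: (H (w x)); rewrite sat_map Hchi; apply=> y ny.
  rewrite /h; case: eqP => [->//|/eqP yx] /=; apply: Hw => -[].
  by rewrite inE (negbTE yx) /= => *; exact: ny.
rewrite sat_map Hchi => w Hw; apply: H => y ny.
have yx : y != x by apply/eqP => yx; apply: ny; rewrite yx inE eqxx.
rewrite Hw; first by rewrite /h (negbTE yx).
by move=> [ys Py]; apply: ny; rewrite inE ys orbT.
Qed.

Lemma formula_exists (L : language) (V : Type) (P : set V)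
  (phi : formula L V) :
  exists chi : formula L V, forall (M : structure L) (v : V -> M),
    sat chi v <->
    exists w : V -> M, (forall x, ~ P x -> w x = v x) /\ sat phi w.
Proof.
have [chi Hchi] := formula_forall P (Fnot phi).
exists (Fnot chi) => M v; rewrite sat_not Hchi; split.
  by move=> /existsNP[w /not_implyP[Hw /contrapT Hphi]]; exists w.
by move=> [w [Hw Hphi]] /(_ w Hw); apply.
Qed.

(** Reduces a formula over any [V] to the finitely many variables that [order_property] and the
    counting of variables require. *)
Lemma formula_finite_variables (L : language) (V : Type) (phi : formula L V) :
  exists (n : nat) (h : 'I_n -> V) (psi : formula L 'I_n),
    forall (M : structure L) (v : V -> M),
      sat psi (fun k => v (h k)) <-> sat phi v.
Proof.
have [[x0]|V0] := pselect (inhabited V); last first.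
  exists 0, (fun k : 'I_0 => False_rect V (notF (ltn_ord k))).
  exists (formula_map (fun x => False_rect 'I_0 (V0 (inhabits x))) phi) => M v.
  by rewrite sat_map; split; apply: sat_congr => x; case: V0; split.
have [s Hs] := formula_support phi.
(* One slot beyond the support keeps the index type inhabited; variables off the support land there,
   and it carries the default [x0]. *)
pose h (k : 'I_(size s).+1) : V := nth (x0 : {classic V}) s k.
pose g (x : V) : 'I_(size s).+1 := inord (index (x : {classic V}) s).
have hg (x : {classic V}) : x \in s -> h (g x) = x.
  by move=> xs; rewrite /h /g inordK ?nth_index// ltnS index_size.
exists (size s).+1, h, (formula_map g phi) => M v.
by rewrite sat_map; split; apply: Hs => x /hg->.
Qed.

Lemma elementarily_equivalent (L : language) (T : set (sentence L))
  (T_complete : complete_theory T) (M N : structure L) (MT : models M T)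
  (NT : models N T) (V : Type) (phi : formula L V) :
  (exists v : V -> M, sat phi v) -> exists v : V -> N, sat phi v.
Proof.
move=> [v0 Hv0]; apply: contrapT => NV.
have [chi Hchi] := formula_forall setT (Fnot phi).
(* The truth of [chi] no longer depends on its variables, so all may be sent to one dummy bound
   variable. *)
pose theta : sentence L := Fall (formula_map (fun _ => None) chi).
have Htheta (Q : structure L) : holds Q theta <-> forall v : V -> Q, ~ sat phi v.
  rewrite /holds sat_all; split=> [H v|H x].
    have [x] := carrier_inhabited Q.
    by move: (H x); rewrite sat_map Hchi; apply => y [].
  by rewrite sat_map Hchi => w _; exact: H.
have [E|E] := T_complete.2 theta.
  by have /Htheta/(_ v0) := E M MT.
by apply: (E N NT); apply/Htheta => v Hv; apply: NV; exists v.
Qed.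

(** * Cardinals and Ramsey's theorem *)

Lemma card_le_lt (T U K : Type) (A : set T) (B : set U) :
  (A #<= B)%card -> card_lt B [set: K] -> card_lt A [set: K].
Proof.
move=> AB [BK KB]; split; first exact: card_le_trans AB BK.
by move=> KA; apply: KB; exact: card_le_trans KA AB.
Qed.

Lemma card_leTP (T U : Type) (A : set U) :
  ([set: T] #<= A)%card <-> exists f : T -> U, injective f /\ range f `<=` A.
Proof.
split=> [/card_leP[f]|[f [f_inj fA]]].
  exists (fun x => \val (f (to_setT x))); split.
    move=> x y /val_inj/(inj (in_setT _) (in_setT _)) /(congr1 \val).
    exact.
  by move=> _ [x _ <-]; exact: set_valP.
apply: card_le_trans (subset_card_le fA).
have /card_eqPle[] // := @inj_card_eq T U setT f (in2W f_inj).
Qed.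

(** [strong_limit] speaks of subsets of [K], so [T] is first embedded in [K]. *)
Lemma card_lt_powerset (K T : Type) : strong_limit K ->
  card_lt [set: T] [set: K] -> card_lt [set: set T] [set: K].
Proof.
move=> Klim TK; have /card_leTP[f [f_inj _]] := TK.1.
apply: card_le_lt (Klim (range f) (card_le_lt (card_image_le _ _) TK)).
apply/card_leTP; exists (fun X => f @` X); split; last first.
  by move=> _ [X _ <-] _ [x _ <-]; exists x.
have aux X Y : f @` X = f @` Y -> X `<=` Y.
  move=> XY x Xx; have [y Yy /f_inj<-//] : (f @` Y) (f x).
  by rewrite -XY; exists x.
by move=> X Y XY; apply/seteqP; split; exact: aux.
Qed.

(* Two powersets leave room for two disjoint copies of [T]. *)
Lemma card_lt_sum (K T : Type) : strong_limit K ->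
  card_lt [set: T] [set: K] -> card_lt [set: T + T] [set: K].
Proof.
move=> Klim TK.
apply: card_le_lt (card_lt_powerset Klim (card_lt_powerset Klim TK)).
apply/card_leTP.
exists (fun z => match z with
  | inl x => [set [set x]] | inr x => [set [set x]; set0] end).
have neq (x y : T) : [set x] <> set0 by move=> E; have : [set x] x by []; rewrite E.
have neq2 (x y : T) : [set [set x]] <> [set [set y]; set0].
  move=> E; have : [set [set x]] (set0 : set T) by rewrite E; right.
  by move=> /esym; exact: neq.
have one (x y : T) : [set x] = [set y] -> x = y.
  by move=> E; have : [set x] x by []; rewrite E.
split=> // -[x|x] [y|y] E; last 1 first.
- congr inr; apply: one; have : [set [set y]; set0] [set x] by rewrite -E; left.
  by case=> // /neq; case.
- congr inl; apply: one; have : [set [set y]] [set x] by rewrite -E.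
  by [].
- by case: (neq2 _ _ E).
- by case: (neq2 _ _ (esym E)).
Qed.

Lemma card_lt_countable (K : Type) (L : language) (T : countType) :
  card_lt [set: formula L nat] [set: K] -> card_lt [set: T] [set: K].
Proof.
apply: card_le_lt; apply: card_le_trans (countableP _) _.
apply/card_leTP; exists (fun n => Feq (Tvar n) (Tvar n)).
by split=> // m n [].
Qed.

Lemma nonprincipal_ultrafilter :
  exists U : set_system nat, UltraFilter U /\ eventually `<=` U.
Proof. exact: ultraFilterLemma eventually_filter. Qed.

Lemma sequence_of_finite_extensions (T : Type) (t0 : T) (P : T -> Prop)
  (R : T -> T -> Prop) :
  (forall (n : nat) (f : nat -> T), (forall k, (k < n)%N -> P (f k)) ->
     exists t, P t /\ forall k, (k < n)%N -> R (f k) t) ->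
  exists f : nat -> T,
    (forall n, P (f n)) /\ forall k l, (k < l)%N -> R (f k) (f l).
Proof.
move=> H.
have /choice[F HF] : forall nf : nat * (nat -> T), exists t,
    (forall k, (k < nf.1)%N -> P (nf.2 k)) ->
    P t /\ forall k, (k < nf.1)%N -> R (nf.2 k) t.
  move=> [n f] /=; have [Hf|nHf] := pselect (forall k, (k < n)%N -> P (f k)).
    by have [t Ht] := H n f Hf; exists t.
  by exists t0.
(* [hist n] records the first [n] terms for the recursion; its values from [n] on are junk. *)
pose fix hist n := if n is m.+1
  then fun k => if (k < m)%N then hist m k else F (m, hist m) else fun=> t0.
pose g n := F (n, hist n).
have histE n k : (k < n)%N -> hist n k = g k.
  elim: n => //= n IH; rewrite ltnS leq_eqVlt => /orP[/eqP->|kn].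
    by rewrite ltnn.
  by rewrite kn IH.
have Pg n : P (g n).
  elim/ltn_ind: n => n IH; apply: (HF (n, hist n) _).1 => k /= kn.
  by rewrite histE//; exact: IH.
exists g; split=> // k l kl; rewrite -(histE l)//.
by apply: (HF (l, hist l) _).2 => // i /= il; rewrite histE.
Qed.

(** For [U]-almost all [i], either [R i j] holds for almost all [j], or its negation does; terms are
    then chosen greedily among such [i]. *)
Lemma ramsey (R : nat -> nat -> Prop) :
  exists s : nat -> nat, (forall k l, (k < l)%N -> (s k < s l)%N) /\
    ((forall k l, (k < l)%N -> R (s k) (s l)) \/
     (forall k l, (k < l)%N -> ~ R (s k) (s l))).
Proof.
have [U [UU evU]] := nonprincipal_ultrafilter.
have greedy (S : nat -> nat -> Prop) : U [set i | U [set j | S i j]] ->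
    exists s : nat -> nat, forall k l, (k < l)%N ->
      (s k < s l)%N /\ S (s k) (s l).
  move=> US.
  have [n f Hf|s [_ Hs]] := @sequence_of_finite_extensions nat 0
    (fun i => U [set j | S i j]) (fun i j => (i < j)%N /\ S i j).
    (* Each of the finitely many requirements on the next term holds on a set in [U], and their
       intersection, again in [U], is nonempty. *)
    suff : U [set t | U [set j | S t j] /\
        forall k, (k < n)%N -> (f k < t)%N /\ S (f k) t].
      by move=> /filter_ex.
    apply: filterI => //; elim: n Hf => [_|n IH Hf].
      by apply: filterS filterT => t _.
    have Ugt : U [set t | (f n < t)%N] by apply: evU; exists (f n).+1.
    apply: filterS (filterI (IH _) (filterI Ugt (Hf n (ltnSn n)))).
      move=> t /= [H1 H2] k; rewrite ltnS leq_eqVlt => /orP[/eqP->//|].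
      exact: H1.
    by move=> k kn; apply: Hf; rewrite ltnS ltnW.
  by exists s => k l /Hs.
have [UA|UA] := in_ultra_setVsetC [set i | U [set j | R i j]] UU.
  have [s Hs] := greedy R UA.
  by exists s; split=> [k l /Hs[]|]//; left=> k l /Hs[].
have [|s Hs] := greedy (fun i j => ~ R i j).
  apply: filterS UA => i; rewrite /= => nU.
  by have [|//] := in_ultra_setVsetC [set j | R i j] UU.
by exists s; split=> [k l /Hs[]|]//; right=> k l /Hs[].
Qed.

(** * Realizing types in saturated structures *)

(* By Zorn's lemma take a maximal partial assignment [G] such that every
   formula of [pi] is satisfied by an extension of [G]; saturation in one
   variable shows that [G] is total. *)
Lemma saturated_realizes (K : Type) (L : language) (N : structure L)
  (X B : Type) (e : B -> N) (pi : set (formula L (X + B))) :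
  card_lt [set: X + B] [set: K] -> saturated K N ->
  (exists phi, pi phi) ->
  (forall phi psi, pi phi -> pi psi -> pi (Fand phi psi)) ->
  (forall phi, pi phi -> exists a : X -> N, sat phi (with_params a e)) ->
  exists a : X -> N, forall phi, pi phi -> sat phi (with_params a e).
Proof.
move=> XBK Nsat [phi0 pi0] pi_and pi_sat.
(* [G] is the graph of a partial assignment; it is single-valued because [pi] contains some
   formula. *)
pose P (G : set (X * N)) := forall phi, pi phi -> exists a : X -> N,
  (forall x n, G (x, n) -> a x = n) /\ sat phi (with_params a e).
have Pfun G x n n' : P G -> G (x, n) -> G (x, n') -> n = n'.
  by move=> /(_ _ pi0)[a [Ha _]] /Ha <- /Ha <-.
have [F FP Ftot|G [PG Gmax]] := @Zorn_bigcup (X * N)%type P.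
  have [[G0 FG0]|F0] := pselect (exists G, F G); last first.
    move=> phi /pi_sat[a Ha]; exists a; split=> // x n [G FG _].
    by case: F0; exists G.
  pose W := \bigcup_(G in F) G.
  have Wfun x n n' : W (x, n) -> W (x, n') -> n = n'.
    move=> [G FG Gn] [G' FG' Gn'].
    have [GG'|G'G] := Ftot G G' FG FG'.
      by apply: (Pfun _ x _ _ (FP _ FG')) => //; exact: GG'.
    by apply: (Pfun _ x _ _ (FP _ FG)) => //; exact: G'G.
  move=> phi piphi; have [s Hs] := formula_support phi.
  (* The formula looks at finitely many variables, so one member of the chain assigns all those
     among them that the union assigns. *)
  have [G [FG HG]] : exists G, F G /\ forall x n,
      (inl x : {classic (X + B)}) \in s -> W (x, n) -> G (x, n).
    elim: s {Hs} => [|z s [G [FG HG]]]; first by exists G0.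
    have [[x [n [zx [G' FG' G'xn]]]]|nz] :=
        pselect (exists x n, z = inl x /\ W (x, n)); last first.
      exists G; split=> // x n; rewrite inE => /orP[/eqP zx|]; last exact: HG.
      by move=> Wxn; case: nz; exists x, n.
    have [H [FH GH G'H]] : exists H, [/\ F H, G `<=` H & G' `<=` H].
      by have [GG'|G'G] := Ftot G G' FG FG'; [exists G'|exists G]; split.
    exists H; split=> // y m; rewrite inE zx => /orP[/eqP[->] Wxm|ys Wym].
      by rewrite (Wfun x m n Wxm) //; [exact: G'H|exists G'].
    by apply: GH; exact: HG.
  have [a [aG Ha]] := FP G FG phi piphi.
  have /choice[a' Ha'] : forall x, exists n, (forall m, W (x, m) -> n = m) /\
      ((~ exists m, W (x, m)) -> n = a x).
    move=> x; have [[n Wn]|nW] := pselect (exists m, W (x, m)).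
      by exists n; split=> [m /(Wfun _ _ _ Wn)//|[]]; exists n.
    by exists (a x); split=> // m Wm; case: nW; exists m.
  exists a'; split=> [x n|]; first exact: (Ha' x).1.
  apply: Hs Ha => -[x|b] //= xs.
  have [[n Wn]|nW] := pselect (exists m, W (x, m)); last by rewrite (Ha' x).2.
  by rewrite ((Ha' x).1 n Wn); apply: aG; exact: HG.
suff /choice[a Ha] : forall x, exists n, G (x, n).
  exists a => phi /PG[a' [Ha']]; apply: sat_congr => -[x|b] //=.
  exact: Ha'.
move=> x0; apply: contrapT => nx0.
(* The parameters of the one-variable type for [x0]: the values assigned so far and the image of
   [e]. *)
pose A := [set n | (exists x, G (x, n)) \/ exists b, e b = n].
have Alt : card_lt A [set: K].
  have [n0] := carrier_inhabited N.
  have /choice[f Hf] : forall x, exists n, forall m, G (x, m) -> n = m.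
    move=> x; have [[n Gn]|nG] := pselect (exists n, G (x, n)).
      by exists n => m; exact: Pfun.
    by exists n0 => m Gm; case: nG; exists m.
  apply: card_le_lt XBK.
  apply: card_le_trans (card_image_le (with_params f e) [set: X + B]).
  apply: subset_card_le => n [[x Gxn]|[b <-]].
    by exists (inl x) => //; exact: Hf.
  by exists (inr b).
have AI n : A n -> exists a : A, \val a = n.
  by move=> An; exists (SigSub (mem_set An)).
(* The other unassigned variables, which [ex] quantifies existentially. *)
pose free (z : X + B) :=
  exists x, [/\ z = inl x, x <> x0 & ~ exists n, G (x, n)].
have /choice[ex Hex] : forall phi : formula L (X + B),
    exists chi : formula L (X + B), forall (M : structure L) (v : X + B -> M),
      sat chi v <->
      exists w : X + B -> M, (forall z, ~ free z -> w z = v z) /\ sat phi w.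
  by move=> phi; exact: (formula_exists free phi).
pose val_of (m : N) := with_params (fun _ : unit => m) (fun a : A => \val a).
(* [h] sends [x0] to the single variable, and assigned variables and parameters to their values in
   [A]; where it sends [free] variables is immaterial. *)
have /choice[h Hh] : forall z : X + B, exists y : unit + A, forall m : N,
    match z with
    | inl x => (x = x0 -> val_of m y = m) /\
               forall n, G (x, n) -> val_of m y = n
    | inr b => val_of m y = e b
    end.
  move=> [x|b].
    have [[n Gn]|nG] := pselect (exists n, G (x, n)).
      have [|a an] := AI n; first by left; exists x.
      exists (inr a) => m; split=> [xx0|n' Gn'].
        by case: nx0; exists n; rewrite -xx0.
      by rewrite /val_of /= an; exact: Pfun Gn Gn'.
    by exists (inl tt) => m; split=> // n Gn; case: nG; exists n.
  have [|a an] := AI (e b); first by right; exists b.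
  by exists (inr a).
have [|m Hm] := Nsat A [set formula_map h (ex phi) | phi in pi] Alt.
  move=> p0 p0p; set Phi := formula L (unit + A).
  move=> /(@finite_seqP {classic Phi})[s sp0].
  have [phi [piphi Hphi]] : exists phi, pi phi /\
      forall theta : {classic Phi}, theta \in s ->
      exists2 phi', theta = formula_map h (ex phi') &
        forall a : X -> N, sat phi (with_params a e) -> sat phi' (with_params a e).
    have : forall theta : {classic Phi}, theta \in s ->
        exists2 phi', pi phi' & formula_map h (ex phi') = theta.
      by move=> theta ts; apply: p0p; rewrite sp0.
    elim: s {sp0} => [|theta s IH] Hs; first by exists phi0.
    have [|phi [piphi Hphi]] := IH.
      by move=> t ts; apply: Hs; rewrite inE ts orbT.
    have [|phi1 pi1 E] := Hs theta; first by rewrite inE eqxx.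
    exists (Fand phi phi1); split; first exact: pi_and.
    move=> t; rewrite inE => /orP[/eqP->|/Hphi[phi' E' Hphi']].
      by exists phi1 => // a /sat_and[].
    by exists phi' => // a /sat_and[/Hphi'].
  have [a [aG Ha]] := PG phi piphi; exists (a x0) => theta.
  rewrite sp0 => /Hphi[phi' -> /(_ _ Ha) Ha']; rewrite /tp /= sat_map Hex.
  exists (with_params a e); split=> // -[x|b] nfree /=; last first.
    by have := Hh (inr b) (a x0).
  have [Hx0 HG] := Hh (inl x) (a x0).
  have [xx0|xx0] := pselect (x = x0); first by rewrite -[RHS]/(val_of _ _) Hx0 ?xx0.
  have [[n Gn]|nG] := pselect (exists n, G (x, n)); last by case: nfree; exists x.
  by rewrite -[RHS]/(val_of _ _) (HG n Gn); exact: aG.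
pose G' := G `|` [set (x0, m)].
apply: (Gmax G').
  split; first by move=> z; left.
  by move=> G'G; apply: nx0; exists m; apply: G'G; right.
move=> phi piphi.
have /Hm : [set formula_map h (ex phi) | phi in pi] (formula_map h (ex phi)).
  by exists phi.
rewrite /tp /= sat_map Hex => -[w [Hw satw]].
have wE z : ~ free z -> w z = val_of m (h z) by exact: Hw.
exists (fun x => w (inl x)); split.
  move=> x n [Gxn|[-> ->]].
    rewrite wE; first exact: (Hh (inl x) m).2.
    by move=> [y [[<-] _]]; apply; exists n.
  rewrite wE; first exact: (Hh (inl x0) m).1.
  by move=> [y [[<-]]].
apply: sat_congr satw => -[x|b] //=.
rewrite wE; first exact: Hh (inr b) m.
by move=> [y []].
Qed.

(** * Definability of types in stable theories *)

Definition sum_map (A B C D : Type) (f : A -> C) (g : B -> D) (z : A + B) :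
    C + D :=
  match z with inl x => inl (f x) | inr y => inr (g y) end.

Lemma sat_sum_map (L : language) (M : structure L) (A B C D : Type)
  (f : A -> C) (g : B -> D) (phi : formula L (A + B)) (u : C -> M) (v : D -> M) :
  sat (formula_map (sum_map f g) phi) (with_params u v) <->
  sat phi (with_params (u \o f) (v \o g)).
Proof. by rewrite sat_map; split; apply: sat_congr => -[]. Qed.

Lemma emb_params (L : language) (M N : structure L)
  (j : elementary_embedding M N) (A B : Type) (phi : formula L (A + B))
  (u : A -> M) (v : B -> M) :
  sat phi (with_params (j \o u) (j \o v)) <-> sat phi (with_params u v).
Proof. by rewrite (emb_sat j); split; apply: sat_congr => -[]. Qed.

(** Existential quantification over the variables in [X] leaves a formula about [e] alone, which [j]
    reflects; [m0] is a mere placeholder. *)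
Lemma emb_exists (L : language) (M N : structure L)
  (j : elementary_embedding M N) (X Y : Type) (phi : formula L (X + Y))
  (e : Y -> M) :
  (exists a : X -> N, sat phi (with_params a (j \o e))) ->
  exists a : X -> M, sat phi (with_params a e).
Proof.
move=> [a Ha]; have [m0] := carrier_inhabited M.
have [chi Hchi] := formula_exists (range inl) phi.
have [|w [Hw satw]] := (Hchi M (with_params (fun=> m0) e)).1.
  apply/(emb_params j)/Hchi; exists (with_params a (j \o e)); split=> // -[x|y] //.
exists (w \o inl); apply: sat_congr satw => -[x|y] //=.
by rewrite Hw// => -[].
Qed.

Lemma stable_no_order (L : language) (T : set (sentence L)) (M : structure L)
  (X Y : Type) (phi : formula L (X + Y)) (a : nat -> X -> M) (b : nat -> Y -> M) :
  stable T -> models M T ->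
  ~ forall k l, sat phi (with_params (a k) (b l)) <-> (k < l)%N.
Proof.
move=> Tst MT Hab; have [m0] := carrier_inhabited M.
have [n [h [psi Hpsi]]] := formula_finite_variables phi.
pose g (k : 'I_n) : 'I_n + 'I_n := if h k is inl _ then inl k else inr k.
apply: (Tst n n (formula_map g psi)); exists M.
exists (fun i k => if h k is inl x then a i x else m0).
exists (fun i k => if h k is inr y then b i y else m0).
split=> // k l; rewrite sat_map -Hab -Hpsi.
by split; apply: sat_congr => i; rewrite /g; case E: (h i) => /=; rewrite E.
Qed.

(** Induction on [n]: [P] is split by the truth value of [psi n], and each half, closed under
    agreement on the earlier formulas, is definable by induction. *)
Lemma boolean_definable (L : language) (M : structure L) (A Y : Type)
  (g : A -> M) (psi : nat -> formula L (A + Y)) (n : nat) (P : set (Y -> M)) :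
  (forall e e', (forall k, (k < n)%N ->
     sat (psi k) (with_params g e) <-> sat (psi k) (with_params g e')) ->
     P e -> P e') ->
  exists d, forall e, sat d (with_params g e) <-> P e.
Proof.
elim: n P => [|n IH] P HP.
  have [[e Pe]|nP] := pselect (exists e, P e).
    exists Ftrue => e'; split=> _; last exact: sat_true.
    exact: HP Pe.
  by exists Fbot => e; split=> // Pe; case: nP; exists e.
pose agree e e' := forall k, (k < n)%N ->
  sat (psi k) (with_params g e) <-> sat (psi k) (with_params g e').
have split_P (Q : Prop) :
    exists d, forall e, sat d (with_params g e) <->
      exists e', [/\ P e', sat (psi n) (with_params g e') <-> Q & agree e' e].
  apply: IH => e e' ee' [e0 [Pe0 Qe0 e0e]]; exists e0; split=> // k kn.
  by rewrite e0e// ee'.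
have [d1 Hd1] := split_P True; have [d0 Hd0] := split_P False.
exists (Fand (Fimp (psi n) d1) (Fimp (Fnot (psi n)) d0)) => e.
rewrite sat_and [sat (Fimp _ _) _]/= [sat (Fimp (Fnot _) _) _]/= Hd1 Hd0.
split=> [[H1 H0]|Pe].
  have [pe|pe] := pselect (sat (psi n) (with_params g e)).
    have [e' [Pe' Qe' e'e]] := H1 pe; apply: HP Pe' => k.
    by rewrite ltnS leq_eqVlt => /orP[/eqP->|/e'e//]; split=> // _; apply/Qe'.
  have [e' [Pe' Qe' e'e]] := H0 pe; apply: HP Pe' => k.
  by rewrite ltnS leq_eqVlt => /orP[/eqP->|/e'e//]; split=> [/Qe'|/pe].
by split=> pe; exists e; split.
Qed.

(* If no Boolean combination of the [phi(a_i, y)] defined the [phi]-type of [a],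
   one could choose [a_i, b_i, c_i] in [M] with [phi(a, b_i)],
   [~ phi(a, c_i)], with [phi(a_i, b_k)] and [~ phi(a_i, c_k)] for [k <= i], and
   with [phi(a_i, b_k) <-> phi(a_i, c_k)] for [i < k]. By Ramsey's theorem one may
   assume that the truth value in the last clause is constant, whence the order
   property for [phi] (with the [c_i]) or for its negation (with the [b_i]). *)
Lemma stable_definable (L : language) (T : set (sentence L))
  (M N : structure L) (j : elementary_embedding M N) (X Y : Type)
  (phi : formula L (X + Y)) (a : X -> N) :
  stable T -> models M T ->
  exists d : formula L (M + Y), forall e : Y -> M,
    sat d (with_params id e) <-> sat phi (with_params a (j \o e)).
Proof.
move=> Tst MT; apply: contrapT => nd; have [m0] := carrier_inhabited M.
pose S := ((X -> M) * (Y -> M) * (Y -> M))%type.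
pose ph (a : X -> M) (e : Y -> M) := sat phi (with_params a e).
pose Ph (e : Y -> M) := sat phi (with_params a (j \o e)).
pose P (t : S) := [/\ Ph t.1.2, ~ Ph t.2, ph t.1.1 t.1.2 & ~ ph t.1.1 t.2].
pose R (t u : S) := [/\ ph t.1.1 u.1.2 <-> ph t.1.1 u.2, ph u.1.1 t.1.2 &
  ~ ph u.1.1 t.2].
have [|f [Pf Rf]] := @sequence_of_finite_extensions S
  ((fun=> m0), (fun=> m0), (fun=> m0)) P R.
  move=> n f Pf.
  pose psi k := formula_map (sum_map (f k).1.1 (@id Y)) phi.
  have [b [c [bc Pb Pc]]] : exists b c, [/\ forall k, (k < n)%N ->
      ph (f k).1.1 b <-> ph (f k).1.1 c, Ph b & ~ Ph c].
    apply: contrapT => nbc; apply: nd.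
    apply: (@boolean_definable L M M Y id psi n Ph) => e e' ee' Pe.
    apply: contrapT => nPe'; apply: nbc; exists e, e'; split=> // k /ee'.
    by rewrite !sat_sum_map.
  (* The pairs already chosen, followed at index [n] by the new pair. *)
  pose g k := if (k < n)%N then ((f k).1.2, (f k).2) else (b, c).
  pose theta k := Fand (formula_map (sum_map (@id X) (g k).1) phi)
    (Fnot (formula_map (sum_map (@id X) (g k).2) phi)).
  (* [a] meets these finitely many conditions in [N], so some tuple of [M] does too. *)
  have [|a' /sat_conj Ha'] :=
      emb_exists (j := j) (phi := Fconj theta n.+1) (e := id).
    exists a; apply/sat_conj => k _; rewrite sat_and sat_not !sat_sum_map /g.
    by case: ifP => // /Pf[].
  have {}Ha' k : (k < n.+1)%N -> ph a' (g k).1 /\ ~ ph a' (g k).2.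
    by move=> /Ha'; rewrite sat_and sat_not !sat_sum_map.
  exists (a', b, c); split.
    by have := Ha' n (ltnSn n); rewrite /g ltnn => -[].
  move=> k kn; have := Ha' k (ltnW kn); rewrite /g kn => -[? ?].
  by split=> //; exact: bc.
have [s [s_inc [Hs|Hs]]] := ramsey (fun k l => ph (f k).1.1 (f l).1.2).
  apply: (@stable_no_order L T M X Y phi (fun k => (f (s k)).1.1)
    (fun k => (f (s k)).2)) => // k l.
  case: (ltngtP k l) => [kl|lk|->]; split=> //.
  - by move=> _; have [bc _ _] := Rf _ _ (s_inc _ _ kl); apply: bc.1; exact: Hs.
  - by have [_ _] := Rf _ _ (s_inc _ _ lk).
  - by have [] := Pf (s l).
apply: (@stable_no_order L T M X Y (Fnot phi) (fun k => (f (s k)).1.1)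
  (fun k => (f (s k)).1.2)) => // k l.
rewrite sat_not; case: (ltngtP k l) => [kl|lk|->]; split=> //.
- by move=> _; exact: Hs.
- by have [] := Rf _ _ (s_inc _ _ lk).
- by have [] := Pf (s l).
Qed.

(** * The semigroup operation of a stable theory *)

Lemma enumeration_section (I : Type) (A : Type) (c : I -> A) :
  (forall x, exists i, c i = x) -> exists s : A -> I, c \o s = id.
Proof. by move=> /choice[s cs]; exists s; apply: funext. Qed.

(** * Complete types over [C] and their realizations *)

Lemma type_space_eq (L : language) (C C' : structure L)
  (j : elementary_embedding C C') (I : Type) (c : I -> C) (p q : type_space j c) :
  (forall phi, tset p phi <-> tset q phi) -> p = q.
Proof.
case: p q => [p Hp] [q Hq] /= pq; have E : p = q by apply/seteqP; split=> ? /pq.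
by case: _ / E Hq {pq} => Hq; congr TypeSpace; exact: Prop_irrelevance.
Qed.

(** As [c] enumerates [C], a realization of the type of [c] amounts to an elementary map on [C]. *)
Lemma type_realizer (L : language) (C C' : structure L)
  (j : elementary_embedding C C') (I : Type) (c : I -> C)
  (c_enum : forall x : C, exists i : I, c i = x) (p : type_space j c) :
  exists f : elementary_embedding C C', tset p = tp j (f \o c).
Proof.
have [s cs] := enumeration_section c_enum.
have [a [ac pa]] := tset_realized p.
have acP theta : sat theta a <-> sat theta (fun i => j (c i)).
  by have /= := congr1 (fun P : set _ => P theta) ac; rewrite /tp0 /= => ->.
have as_sat V (phi : formula L V) (v : V -> C) :
    sat phi v <-> sat phi (fun x => a (s (v x))).
  rewrite -(sat_map (s \o v) phi a) acP sat_map (emb_sat j).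
  by split; apply: sat_congr => x /=; rewrite -[c _]/((c \o s) (v x)) cs.
exists (@ElementaryEmbedding L C C' (a \o s) as_sat); rewrite pa.
congr tp; apply: funext => i.
(* [a] repeats wherever [c] does, since an equation between two variables that holds of [c] holds of
   [a]. *)
apply/(acP (Feq (Tvar i) (Tvar (s (c i))))) => /=.
by rewrite -[c (s _)]/((c \o s) (c i)) cs.
Qed.

(** With [p] the type of [f(c)], the universal closure over the parameter variables passes from [c]
    to [f(c)] and is then specialized to [j]. *)
Lemma type_transfer (L : language) (C C' : structure L)
  (j : elementary_embedding C C') (I : Type) (c : I -> C)
  (c_enum : forall x : C, exists i : I, c i = x) (p : type_space j c)
  (phi : formula L (I + C)) :
  (forall e : C -> C, sat phi (with_params c e)) -> tset p phi.
Proof.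
move=> Hphi; have [f ->] := type_realizer c_enum p.
have [chi Hchi] := formula_forall (range inr) phi.
have : sat chi (with_params (f \o c) (f \o id)).
  apply/emb_params/Hchi => w Hw; apply: sat_congr (Hphi (w \o inr)) => -[i|x] //=.
  by rewrite Hw// => -[].
by move=> /Hchi; apply=> -[].
Qed.

Lemma type_imp (L : language) (C C' : structure L)
  (j : elementary_embedding C C') (I : Type) (c : I -> C) (p : type_space j c)
  (phi psi : formula L (I + C)) :
  tset p (Fimp phi psi) <-> (tset p phi -> tset p psi).
Proof. by have [a [_ ->]] := tset_realized p. Qed.

Lemma type_and (L : language) (C C' : structure L)
  (j : elementary_embedding C C') (I : Type) (c : I -> C) (p : type_space j c)
  (phi psi : formula L (I + C)) :
  tset p (Fand phi psi) <-> tset p phi /\ tset p psi.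
Proof. by have [a [_ ->]] := tset_realized p; exact: sat_and. Qed.

Lemma type_not (L : language) (C C' : structure L)
  (j : elementary_embedding C C') (I : Type) (c : I -> C) (p : type_space j c)
  (phi : formula L (I + C)) : tset p (Fnot phi) <-> ~ tset p phi.
Proof. by have [a [_ ->]] := tset_realized p. Qed.

Lemma type_true (L : language) (C C' : structure L)
  (j : elementary_embedding C C') (I : Type) (c : I -> C) (p : type_space j c) :
  tset p Ftrue.
Proof. by have [a [_ ->]] := tset_realized p; exact: sat_true. Qed.

(** Dually, closing over the variables in [I] gives a statement about the parameters, which [j]
    preserves and which is then specialized to [f]. *)
Lemma type_valid (L : language) (C C' : structure L)
  (j : elementary_embedding C C') (I : Type) (c : I -> C)
  (c_enum : forall x : C, exists i : I, c i = x) (p : type_space j c)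
  (phi : formula L (I + C)) :
  (forall w : C -> C, sat phi (with_params (w \o c) id)) -> tset p phi.
Proof.
move=> Hphi; have [f ->] := type_realizer c_enum p.
have [s cs] := enumeration_section c_enum.
(* Renaming the variables along [c] makes the quantified tuples respect the repetitions in [c]. *)
pose phi' := formula_map (sum_map c (@id C)) phi.
have [chi Hchi] := formula_forall (range inl) phi'.
have : sat chi (with_params (f \o id) (j \o id)).
  have : sat chi (with_params (j \o id) (j \o id)).
    apply/emb_params/Hchi => w Hw.
    rewrite (_ : w = with_params (w \o inl) id).
      by rewrite sat_sum_map; exact: Hphi.
    by apply: funext => -[x|x] //=; rewrite Hw// => -[].
  move=> /Hchi H; apply/Hchi => w Hw; apply: H => -[x|x] // _.
  by rewrite Hw// => -[].
move=> /Hchi/(_ (with_params f j)); rewrite sat_sum_map; apply=> -[x|x] //.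
Qed.

(* Compactness of [S_c(C)]: the hypotheses say that [S] is a complete type over
   [C], in variables that respect the repetitions in [c], extending the type of
   [c] over the empty set. *)
Lemma complete_type_realized (L : language) (C C' : structure L) (K' : Type)
  (C'_monster : monster K' C') (C'_bigger : card_lt [set: C] [set: K'])
  (j : elementary_embedding C C') (I : Type) (c : I -> C)
  (c_enum : forall x : C, exists i : I, c i = x) (S : set (formula L (I + C))) :
  (forall phi psi, S (Fimp phi psi) <-> (S phi -> S psi)) -> ~ S Fbot ->
  (forall phi, (forall w : C -> C, sat phi (with_params (w \o c) id)) -> S phi) ->
  (forall theta : formula L I, sat theta c -> S (formula_map inl theta)) ->
  exists a : I -> C', tp0 a = tp0 (fun i => j (c i)) /\ S = tp j a.
Proof.
move=> S_imp S_bot S_valid S_c; have [s cs] := enumeration_section c_enum.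
have [K'lim _ K'sat _] := C'_monster.
have S_not phi : S (Fnot phi) <-> ~ S phi.
  by rewrite S_imp; split=> H /H.
(* Elements of [C] replace the variables in [I], which keeps their number below [K']. *)
pose pi : set (formula L (C + C)) :=
  [set psi | S (formula_map (sum_map s id) psi)].
have [||phi psi piphi pipsi|psi pipsi|h Hh] :=
    @saturated_realizes K' L C' C C j pi _ K'sat.
- exact: card_lt_sum.
- by exists Ftrue; apply: S_valid => w; exact: sat_true.
- by apply/S_not => /S_imp/(_ piphi)/S_not; apply.
- apply: contrapT => npsi; have : S (Fnot (formula_map (sum_map s id) psi)).
    apply: S_valid => w; rewrite sat_not sat_sum_map => Hpsi.
    by apply: npsi; exists (j \o (w \o c \o s)); apply/(emb_params j).
  by move=> /S_not; apply.
have {}Hh psi : sat psi (with_params h j) <-> pi psi.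
  split=> [Hpsi|]; last exact: Hh.
  by apply: contrapT => /S_not/(Hh (Fnot psi)); apply.
have Sh phi : S phi <-> sat phi (with_params (h \o c) j).
  have -> : sat phi (with_params (h \o c) j) <->
      sat (formula_map (sum_map c id) phi) (with_params h j).
    by rewrite sat_sum_map.
  rewrite Hh /pi /=.
  (* Renaming [i] to [s (c i)] does not affect [phi] on tuples [w \o c], so by [S_valid] both
     versions are equivalent in [S]. *)
  have cscs (w : C -> C) : (w \o c) \o s \o c = w \o c.
    by rewrite -(compA w c s) cs.
  by split; apply/S_imp/S_valid => w /=; rewrite !sat_sum_map cscs.
exists (h \o c); split; last by apply/seteqP; split=> phi /Sh.
have tp0h theta : sat theta c -> sat theta (h \o c).
  by move=> /S_c/Sh; rewrite sat_map.
apply/seteqP; split=> theta; rewrite /tp0 /= -(emb_sat j theta c); last exact: tp0h.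
by move=> Hh'; apply: contrapT => /(tp0h (Fnot theta)); apply.
Qed.

(** * Defining schemes and the product of two types *)

Definition subst_params (L : language) (I B D : Type) (e : B -> D)
    (phi : formula L (I + B)) : formula L (I + D) :=
  formula_map (sum_map id e) phi.

Lemma subst_params_comp (L : language) (I A B D : Type) (e : B -> D) (e' : A -> B)
  (phi : formula L (I + A)) :
  subst_params e (subst_params e' phi) = subst_params (e \o e') phi.
Proof.
rewrite /subst_params formula_map_comp; congr formula_map.
by apply: funext => -[].
Qed.

Lemma subst_params_id (L : language) (I A : Type) (phi : formula L (I + A)) :
  subst_params id phi = phi.
Proof.
rewrite -[RHS]formula_map_id /subst_params; congr formula_map.
by apply: funext => -[].
Qed.

Lemma sat_subst_params (L : language) (M : structure L) (I B D : Type)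
  (e : B -> D) (phi : formula L (I + B)) (u : I -> M) (v : D -> M) :
  sat (subst_params e phi) (with_params u v) <->
  sat phi (with_params u (v \o e)).
Proof. exact: sat_sum_map. Qed.

(* [d] is a defining formula for the restriction of [q] to the instances of
   [phi]; its parameters are written as the variables in [I], to be evaluated at
   the enumeration [c] of [C]. *)
Definition defines (L : language) (C C' : structure L)
    (j : elementary_embedding C C') (I : Type) (c : I -> C) (q : type_space j c)
    (phi d : formula L (I + C)) : Prop :=
  forall e : C -> C, sat d (with_params c e) <-> tset q (subst_params e phi).

(* If [p = tp(f(c)/C)] for an elementary [f : C -> C'], this is the restriction
   to [C] of the extension to [C'] of the definable type [f(q)]. *)
Definition star (L : language) (C C' : structure L)
    (j : elementary_embedding C C') (I : Type) (c : I -> C)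
    (p q : type_space j c) : set (formula L (I + C)) :=
  [set phi | exists2 d, defines q phi d & tset p d].

(** The choice of [d] does not matter: two defining formulas agree at [c] for all parameters, hence
    also in [p] by [type_transfer]. *)
Lemma starE (L : language) (C C' : structure L)
  (j : elementary_embedding C C') (I : Type) (c : I -> C)
  (c_enum : forall x : C, exists i : I, c i = x) (p q : type_space j c)
  (phi d : formula L (I + C)) :
  defines q phi d -> star p q phi <-> tset p d.
Proof.
move=> Hd; split=> [[d' Hd' pd']|pd]; last by exists d.
have /type_imp : tset p (Fimp d' d); last exact.
by apply: type_transfer => // e /=; rewrite Hd Hd'.
Qed.

Lemma type_definable (L : language) (T : set (sentence L)) (C C' : structure L)
  (CT : models C T) (T_stable : stable T)
  (j : elementary_embedding C C') (I : Type) (c : I -> C)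
  (c_enum : forall x : C, exists i : I, c i = x) (q : type_space j c)
  (phi : formula L (I + C)) : exists d, defines q phi d.
Proof.
have [s cs] := enumeration_section c_enum.
have [f qf] := type_realizer c_enum q.
have [d Hd] := stable_definable j phi (f \o c) T_stable CT.
exists (formula_map (sum_map s id) d) => e.
by rewrite sat_sum_map cs Hd qf /tp /= sat_subst_params.
Qed.

(** The conditions of a complete type hold in [q]; they become relations between defining formulas,
    which carry over to [p]. *)
Lemma star_realized (L : language) (T : set (sentence L)) (C C' : structure L)
  (CT : models C T) (T_stable : stable T) (K' : Type)
  (C'_monster : monster K' C') (C'_bigger : card_lt [set: C] [set: K'])
  (j : elementary_embedding C C') (I : Type) (c : I -> C)
  (c_enum : forall x : C, exists i : I, c i = x) (p q : type_space j c) :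
  exists a : I -> C', tp0 a = tp0 (fun i => j (c i)) /\ star p q = tp j a.
Proof.
have def phi := type_definable CT T_stable c_enum q phi.
have [g qg] := type_realizer c_enum q.
apply: (@complete_type_realized L C C' K' C'_monster C'_bigger j I c c_enum).
- move=> phi psi; have [d Hd] := def phi; have [d' Hd'] := def psi.
  rewrite (starE c_enum p Hd) (starE c_enum p Hd') -type_imp; apply: starE => // e.
  have -> : subst_params e (Fimp phi psi) =
      Fimp (subst_params e phi) (subst_params e psi) by [].
  by rewrite type_imp -Hd -Hd'.
- have /(starE c_enum p)-> : defines q Fbot Fbot.
    by move=> e; have [a [_ ->]] := tset_realized q.
  by have [a [_ ->]] := tset_realized p.
- move=> phi Hphi; have [d Hd] := def phi; apply/(starE c_enum p Hd).
  (* [chi], a condition on the parameters alone, says that [phi] holds of every tuple respecting the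
     repetitions; it therefore implies [d] at [c]. *)
  have [chi Hchi] := formula_forall (range inl)
    (formula_map (sum_map c (@id C)) phi).
  have [s cs] := enumeration_section c_enum.
  have /type_imp : tset p (Fimp (formula_map (sum_map s id) chi) d).
    apply: type_transfer => // e /=; rewrite sat_sum_map cs Hd qg.
    move=> /(emb_params j)/Hchi; rewrite /tp /= sat_subst_params.
    move=> /(_ (with_params g (j \o e))).
    by rewrite sat_sum_map; apply=> -[x nx|x //]; case: nx; exists x.
  apply; apply: type_valid => // w; rewrite sat_sum_map; apply/Hchi => w' Hw'.
  rewrite (_ : w' = with_params (w' \o inl) id).
    by rewrite sat_sum_map; exact: Hphi.
  by apply: funext => -[x|x] //=; rewrite Hw'// => -[].
- move=> theta Hc.
  have /(starE c_enum p)-> : defines q (formula_map inl theta) Ftrue;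
    last exact: type_true.
  move=> e; rewrite qg /tp /= sat_subst_params sat_map.
  by split=> _; [apply/(emb_sat g theta c)|exact: id].
Qed.

(** Conjunction turns the subbasic clopen sets into a base. *)
Lemma nbhs_type_space (L : language) (C C' : structure L)
  (j : elementary_embedding C C') (I : Type) (c : I -> C) (p : type_space j c)
  (A : set (type_space j c)) :
  nbhs p A <-> exists2 phi, tset p phi & basic_clopen phi `<=` A.
Proof.
split.
  rewrite nbhsE => -[_ [[B sB <-] [D BD Dp] sUBA]].
  have /sB [E sE IED] := BD.
  pose F : set_system (type_space j c) :=
    [set X | exists2 phi, tset p phi & basic_clopen phi `<=` X].
  have FF : Filter F.
    split=> [|X Y [phi pphi HX] [psi ppsi HY]|X Y XY [phi pphi HX]].
    - by exists Ftrue; first exact: type_true.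
    - exists (Fand phi psi); first exact/type_and.
      by move=> r /type_and[/HX ? /HY].
    - by exists phi => // r /HX/XY.
  have : F A; last by [].
  apply: filterS sUBA _; apply: (@filterS _ F FF D) => [r Dr|]; first by exists D.
  rewrite -IED; apply: filter_bigI => X XE.
  have := sE X XE; rewrite inE => -[phi _ phiX].
  have : isSubBaseTopological.b X p by move: Dp; rewrite -IED; apply.
  by rewrite /= -phiX => pphi; exists phi.
move=> [phi pphi phiA].
suff : open (basic_clopen phi : set (type_space j c)).
  by move=> phi_open; apply: filterS phiA _; exact: open_nbhs_nbhs.
exists [set basic_clopen phi]; last by rewrite bigcup_set1.
move=> _ ->; apply: (@finI_from1 _ _ (range (@basic_clopen L C C' j I c)) id).
by exists phi.
Qed.

Lemma aut_actP (L : language) (C : structure L) (I : Type)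
  (sigma : automorphism C) (tau : C -> C) (q : set (formula L (I + C)))
  (phi : formula L (I + C)) :
  cancel sigma tau -> cancel tau sigma ->
  aut_act sigma q phi <-> q (subst_params tau phi).
Proof.
move=> sK tK; have -> : aut_act sigma q = subst_params sigma @` q.
  rewrite /aut_act /subst_params.
  suff -> : (fun z : I + C => match z with
      | inl i => inl i | inr b => inr (sigma b) end) = sum_map id sigma by [].
  by apply: funext => -[].
split=> [[psi qpsi <-]|Hq].
  rewrite subst_params_comp (_ : tau \o sigma = id) ?subst_params_id//.
  exact: funext.
exists (subst_params tau phi) => //.
rewrite subst_params_comp (_ : sigma \o tau = id) ?subst_params_id//.
exact: funext.
Qed.

Lemma stable_semigroup (L : language) (T : set (sentence L)) (C C' : structure L)
  (CT : models C T) (T_stable : stable T) (K' : Type)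
  (C'_monster : monster K' C') (C'_bigger : card_lt [set: C] [set: K'])
  (j : elementary_embedding C C') (I : Type) (c : I -> C)
  (c_enum : forall x : C, exists i : I, c i = x) :
  exists op : type_space j c -> type_space j c -> type_space j c,
    [/\ associative op, left_continuous op & extends_aut_action op].
Proof.
have def q phi := type_definable CT T_stable c_enum (q : type_space j c) phi.
pose op (p q : type_space j c) : type_space j c := TypeSpace
  (star_realized CT T_stable C'_monster C'_bigger c_enum p q).
have opE p q phi d : defines q phi d -> tset (op p q) phi <-> tset p d.
  exact: starE.
exists op; split.
- move=> p q r; apply: type_space_eq => phi.
  (* [d'] defines the instances of [d] in [q], hence those of [phi] in [op q r]. *)
  have [d Hd] := def r phi; have [d' Hd'] := def q d.
  rewrite (opE _ r _ _ Hd) (opE _ q _ _ Hd'); apply: (opE) => e.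
  rewrite Hd' (opE q r (subst_params e phi) (subst_params e d))// => e'.
  by rewrite sat_subst_params Hd subst_params_comp.
- move=> q p A /nbhs_type_space[phi pphi Hphi]; apply/nbhs_type_space.
  have [d Hd] := def q phi; exists d; first exact/(opE _ _ _ _ Hd).
  by move=> r /(opE _ _ _ _ Hd)/Hphi.
- move=> sigma q; apply/seteqP.
  have [tau sK tK] := aut_bij sigma.
  suff E phi : tset (op (aut_type j c sigma) q) phi <-> aut_act sigma q phi.
    by split=> phi /E.
  have [d Hd] := def q phi.
  rewrite (opE _ _ _ _ Hd) (aut_actP _ _ sK tK) -Hd.
  rewrite -[tset _ _]/(sat d (with_params (j \o (sigma \o c)) (j \o id))).
  rewrite emb_params -(sat_aut sigma d (with_params c tau)).
  by split; apply: sat_congr => -[i|x] //=; rewrite tK.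
Qed.

(** * Ultralimits and the converse *)

Lemma ultra_not (J : Type) (U : set_system J) (UU : UltraFilter U) (A : set J) :
  U (~` A) <-> ~ U A.
Proof.
split=> [UnA UA|nUA]; last by case: (in_ultra_setVsetC A UU).
by have /filter_ex[x []] : U (A `&` ~` A) by exact: filterI.
Qed.

(** The formulas true along [U] form a complete type because [U] is ultra, and compactness realizes
    it. *)
Lemma type_ultralimit (L : language) (C C' : structure L) (K' : Type)
  (C'_monster : monster K' C') (C'_bigger : card_lt [set: C] [set: K'])
  (j : elementary_embedding C C') (I : Type) (c : I -> C)
  (c_enum : forall x : C, exists i : I, c i = x) (J : Type) (U : set_system J)
  (UU : UltraFilter U) (t : J -> type_space j c) :
  exists p : type_space j c,
    forall phi, tset p phi <-> U [set i | tset (t i) phi].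
Proof.
have all_U phi : (forall i, tset (t i) phi) -> U [set i | tset (t i) phi].
  by move=> Hphi; apply: filterS filterT => i _; exact: Hphi.
have [||||a [ac Sa]] := @complete_type_realized L C C' K' C'_monster C'_bigger
    j I c c_enum [set phi | U [set i | tset (t i) phi]].
- move=> phi psi; split=> [Uimp Uphi|H].
    by apply: filterS (filterI Uimp Uphi) => i [/type_imp].
  have [/H|] := in_ultra_setVsetC [set i | tset (t i) phi] UU.
    by apply: filterS => i Hpsi; apply/type_imp.
  by apply: filterS => i nphi; apply/type_imp => /nphi.
- move=> /filter_ex[i] /=; have [a [_ ->]] := tset_realized (t i); exact.
- by move=> phi Hphi; apply: all_U => i; exact: type_valid.
- move=> theta Hc; apply: all_U => i; have [a [ac ->]] := tset_realized (t i).
  rewrite /tp /= sat_map -[sat _ _]/(tp0 a theta) ac.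
  exact/(emb_sat j theta c).
have p_real : exists a : I -> C', tp0 a = tp0 (fun i => j (c i)) /\
    [set phi | U [set i | tset (t i) phi]] = tp j a by exists a.
by exists (TypeSpace p_real).
Qed.

Lemma aut_typeP (L : language) (C C' : structure L)
  (j : elementary_embedding C C') (I : Type) (c : I -> C)
  (sigma : automorphism C) (phi : formula L (I + C)) :
  tset (aut_type j c sigma) phi <-> sat phi (with_params (sigma \o c) id).
Proof. exact: (emb_params j phi (sigma \o c) id). Qed.

(** [strongly_homogeneous] concerns maps on sets, whereas [u] may have repetitions; a section of [u]
    helps, since [v] has the same repetitions. *)
Lemma homogeneous_tuple (K : Type) (L : language) (M : structure L) (X : Type)
  (u v : X -> M) :
  card_lt [set: X] [set: K] -> strongly_homogeneous K M -> tp0 u = tp0 v ->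
  exists sigma : automorphism M, forall x, sigma (u x) = v x.
Proof.
move=> XK Mhom uv.
have uvP theta : sat theta u <-> sat theta v.
  by have /= := congr1 (fun P : set _ => P theta) uv; rewrite /tp0 /= => ->.
have /choice[s us] : forall a : range u, exists x, u x = \val a.
  by move=> a; have [x _ ax] := set_valP a; exists x.
have [||sigma Hsigma] := Mhom (range u) (v \o s).
- exact: card_le_lt (card_image_le _ _) XK.
- apply/seteqP; rewrite /tp0; split=> theta /=.
    rewrite -(sat_map s theta v) -uvP sat_map.
    by apply: sat_congr => a /=; rewrite us.
  move=> Hu; rewrite -(sat_map s theta v) -uvP sat_map.
  by apply: sat_congr Hu => a; rewrite us.
exists sigma => x.
pose a : range u := SigSub (mem_set (imageP u (I : setT x))).
rewrite -[u x]/(\val a) Hsigma /=.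
apply/(uvP (Feq (Tvar (s a)) (Tvar x))) => /=.
by rewrite us.
Qed.

Lemma inverse_automorphism (L : language) (M : structure L)
  (sigma : automorphism M) :
  exists tau : automorphism M, cancel sigma tau /\ cancel tau sigma.
Proof.
have [tau sK tK] := aut_bij sigma.
have taus (X : Type) (xs : X -> M) : (fun i => sigma (tau (xs i))) = xs.
  by apply: funext => i; rewrite tK.
unshelve eexists (@Automorphism L M tau _ _ _); last by [].
- by exists sigma.
- by move=> f xs; apply: (can_inj sK); rewrite tK aut_finterp taus.
- by move=> r xs; rewrite [X in _ <-> X](aut_rinterp sigma) taus.
Qed.

Lemma increasing_sequence_in (U : set_system nat) (UU : UltraFilter U)
  (A : set nat) :
  eventually `<=` U -> U A ->
  exists s : nat -> nat,
    (forall k l, (k < l)%N -> (s k < s l)%N) /\ forall k, A (s k).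
Proof.
move=> evU UA.
have [n f _|s [As Hs]] := @sequence_of_finite_extensions nat 0 A
  (fun k l => (k < l)%N); last by exists s.
suff : U [set t | A t /\ forall k, (k < n)%N -> (f k < t)%N] by move=> /filter_ex.
apply: filterI => //; elim: n => [|n IH]; first by apply: filterS filterT => t _.
have Ugt : U [set t | (f n < t)%N] by apply: evU; exists (f n).+1.
apply: filterS (filterI IH Ugt) => t /= [H1 H2] k.
by rewrite ltnS leq_eqVlt => /orP[/eqP->//|]; exact: H1.
Qed.

(* The formulas of [pi] are those that hold of [(a_s(k), b_s(k))_k] for all
   increasing [s] with values in some set of the ultrafilter; this makes the types
   of the [a i] and of the [b i] constant. *)
Lemma order_property_monster (K : Type) (L : language) (T : set (sentence L))
  (T_complete : complete_theory T) (C : structure L) (C_models : models C T)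
  (C_monster : monster K C) (n m : nat) (phi : formula L ('I_n + 'I_m)) :
  order_property T phi ->
  exists (a : nat -> 'I_n -> C) (b : nat -> 'I_m -> C),
    [/\ forall k l, sat phi (with_params (a k) (b l)) <-> (k < l)%N,
        forall k, tp0 (a 0) = tp0 (a k) & forall k, tp0 (b 0) = tp0 (b k)].
Proof.
move=> [M [a0 [b0 [MT OP]]]]; have [_ LK C_sat _] := C_monster.
have {}OP k l : sat phi (with_params (a0 k) (b0 l)) <-> (k < l)%N := OP k l.
have [U [UU evU]] := nonprincipal_ultrafilter.
pose X := (nat * ('I_n + 'I_m))%type.
pose asg (s : nat -> nat) (z : X) := with_params (a0 (s z.1)) (b0 (s z.1)) z.2.
pose increasing (s : nat -> nat) := forall k l, (k < l)%N -> (s k < s l)%N.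
pose pi : set (formula L (X + void)) := [set psi | exists A, U A /\
  forall s, increasing s -> (forall k, A (s k)) ->
    sat psi (with_params (asg s) (of_void M))].
have [||psi psi' [A [UA HA]] [A' [UA' HA']]|psi [A [UA HA]]|y Hy] :=
    @saturated_realizes K L C X void (of_void C) pi _ C_sat.
- exact: card_lt_countable LK.
- by exists Ftrue, setT; split=> [|*]; [exact: filterT|exact: sat_true].
- exists (A `&` A'); split; first exact: filterI.
  move=> s s_inc As; apply/sat_and; split; first by apply: HA => // k; case: (As k).
  by apply: HA' => // k; case: (As k).
(* [psi] is satisfied in [M] along an increasing sequence in [A]; completeness of [T] carries its
   satisfiability to [C]. *)
- have [s [s_inc As]] := increasing_sequence_in UU evU UA.
  have [|v Hv] := elementarily_equivalent T_complete MT C_models (phi := psi).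
    by eexists; exact: HA s_inc As.
  by exists (v \o inl); apply: sat_congr Hv => -[z|[]].
exists (fun k i => y (k, inl i)), (fun k i => y (k, inr i)).
have const_type V (g : V -> 'I_n + 'I_m) k :
    tp0 (fun x => y (0, g x)) = tp0 (fun x => y (k, g x)).
  have type_sub theta :
      (forall k, sat theta (fun x => y (k, g x))) \/
      (forall k, ~ sat theta (fun x => y (k, g x))).
    (* Whichever of [A] and its complement is in [U] decides [theta] at every position at once. *)
    pose A := [set k | sat theta (fun x => with_params (a0 k) (b0 k) (g x))].
    pose inst k := formula_map (fun x => inl (k, g x) : X + void) theta.
    have [UA|UnA] := in_ultra_setVsetC A UU; [left|right] => k'.
      have /Hy : pi (inst k'); last by rewrite sat_map.
      by exists A; split=> // s _ As; rewrite sat_map; exact: As.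
    have /Hy : pi (Fnot (inst k')); last by rewrite sat_not sat_map.
    by exists (~` A); split=> // s _ As; rewrite sat_not sat_map; exact: As.
  by apply/seteqP; split=> theta; rewrite /tp0 /=; case: (type_sub theta) => H // /H.
split=> [k l|k|k]; [|exact: (const_type 'I_n inl k)|exact: (const_type 'I_m inr k)].
pose psi := formula_map (fun z => match z with
  | inl i => inl (k, inl i) | inr i => inl (l, inr i) end : X + void) phi.
have psiP (N : structure L) (v : X + void -> N) : sat psi v <->
    sat phi (with_params (fun i => v (inl (k, inl i)))
                         (fun i => v (inl (l, inr i)))).
  by rewrite sat_map; split; apply: sat_congr => -[].
have [kl|lk] := ltnP k l; split=> //.
  move=> _; have /Hy/psiP // : pi psi.
  exists setT; split; first exact: filterT.
  by move=> s s_inc _; apply/psiP/(OP (s k) (s l)); exact: s_inc.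
move=> Hphi; have /Hy : pi (Fnot psi); last by rewrite sat_not psiP.
exists setT; split; first exact: filterT.
move=> s s_inc _; rewrite sat_not psiP => /(OP (s k) (s l)); apply/negP.
by rewrite -leqNgt; move: lk; rewrite leq_eqVlt => /orP[/eqP->//|/s_inc/ltnW].
Qed.

(* The last clause says that the type of [rho(c)] lies in the neighbourhood
   [chi] of the limit of the types of the [sigma_l^-1(c)]. *)
Lemma automorphism_past_sequence (K : Type) (L : language) (C : structure L)
  (C_monster : monster K C) (I : Type) (c : I -> C) (n m : nat)
  (phi : formula L ('I_n + 'I_m)) (a : nat -> 'I_n -> C) (b : nat -> 'I_m -> C)
  (sigma : nat -> automorphism C) (U : set_system nat) (UU : UltraFilter U)
  (evU : eventually `<=` U) (chi : formula L (I + C)) :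
  (forall k l, sat phi (with_params (a k) (b l)) <-> (k < l)%N) ->
  (forall l i, sigma l (b 0 i) = b l i) ->
  U [set l | sat chi (with_params c (sigma l))] ->
  exists (rho : automorphism C) (b' : 'I_m -> C),
    [/\ forall i, rho (b' i) = b 0 i,
        forall k, sat phi (with_params (a k) b') &
        sat chi (with_params (rho \o c) id)].
Proof.
move=> OP sigma_b Uchi; have [_ LK C_sat C_hom] := C_monster.
have [N [h [psi Hpsi]]] := formula_finite_variables chi.
pose d (k : 'I_N) : C := match h k with inl i => c i | inr x => x end.
(* The unknowns stand for the preimages of [d] and [b 0] under [rho]; the parameters are [d] and all
   the [a k]. *)
pose X := ('I_N + 'I_m)%type; pose B := ('I_N + nat * 'I_n)%type.
pose e : B -> C := with_params d (fun z => a z.1 z.2).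
pose t : X -> C := with_params d (b 0).
(* The limit type of the images of [t] under [sigma l]; these all have the type of [t], so
   homogeneity will provide [rho]. *)
pose pi : set (formula L (X + B)) :=
  [set theta | U [set l | sat theta (with_params (sigma l \o t) e)]].
have [||theta theta' Ut Ut'|theta /filter_ex[l Hl]|w Hw] :=
    @saturated_realizes K L C X B e pi _ C_sat.
- exact: card_lt_countable LK.
- by exists Ftrue; apply: filterS filterT => l _; exact: sat_true.
- by apply: filterS (filterI Ut Ut') => l [? ?]; apply/sat_and.
- by exists (sigma l \o t).
have wt : tp0 w = tp0 t.
  have sub theta : sat theta t -> sat theta w.
    move=> Ht; have /Hw : pi (formula_map inl theta); last by rewrite sat_map.
    by apply: filterS filterT => l _; rewrite /= sat_map; apply/sat_aut.
  apply/seteqP; split=> theta; last exact: sub.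
  by rewrite /tp0 /= => Ht; apply: contrapT => /(sub (Fnot theta)); apply.
have [rho Hrho] := homogeneous_tuple (card_lt_countable _ LK) C_hom wt.
exists rho, (w \o inr); split=> [i|k|]; first exact: Hrho.
  pose g (z : 'I_n + 'I_m) : X + B :=
    match z with inl i => inr (inr (k, i)) | inr i => inl (inr i) end.
  have /Hw : pi (formula_map g phi).
    apply: filterS (evU [set l | (k < l)%N] _); last by exists k.+1.
    by move=> l /OP kl; rewrite /= sat_map; apply: sat_congr kl => -[i|i] //=.
  by rewrite sat_map; apply: sat_congr => -[].
(* The entries of [c] stay fixed and the parameters become unknowns: moving [c] by [rho] amounts to
   moving the parameters by its inverse. *)
pose g (k : 'I_N) : X + B := if h k is inl _ then inr (inl k) else inl (inl k).
have /Hw : pi (formula_map g psi).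
  apply: filterS Uchi => l; rewrite /= -Hpsi sat_map.
  by apply: sat_congr => k; rewrite /g; case E: (h k) => /=; rewrite /e /t /= /d E.
rewrite sat_map -Hpsi -(sat_aut rho); apply: sat_congr => k.
by rewrite /g /d; case E: (h k) => //=; rewrite ?Hrho /= /d E.
Qed.

Lemma semigroup_stable (L : language) (T : set (sentence L))
  (T_complete : complete_theory T) (K : Type) (C : structure L)
  (C_models : models C T) (C_monster : monster K C) (K' : Type)
  (C' : structure L) (C'_monster : monster K' C')
  (C'_bigger : card_lt [set: C] [set: K']) (j : elementary_embedding C C')
  (I : Type) (c : I -> C) (c_enum : forall x : C, exists i : I, c i = x)
  (op : type_space j c -> type_space j c -> type_space j c) :
  left_continuous op -> extends_aut_action op -> stable T.
Proof.
move=> op_cont op_ext n m phi.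
move=> /(order_property_monster T_complete C_models C_monster)[a [b [OP ta tb]]].
have [_ LK _ C_hom] := C_monster; have [s cs] := enumeration_section c_enum.
have csE x : c (s x) = x by rewrite -[LHS]/((c \o s) x) cs.
have [U [UU evU]] := nonprincipal_ultrafilter.
have /choice[tau Htau] k : exists f : automorphism C, forall i, f (a 0 i) = a k i.
  exact: homogeneous_tuple (card_lt_countable _ LK) C_hom (ta k).
have /choice[sigma Hsigma] l :
    exists f : automorphism C, forall i, f (b 0 i) = b l i.
  exact: homogeneous_tuple (card_lt_countable _ LK) C_hom (tb l).
have /choice[sigma' Hsigma'] l := inverse_automorphism (sigma l).
have [q Hq] := type_ultralimit C'_monster C'_bigger c_enum UU
  (fun k => aut_type j c (tau k)).
have [p Hp] := type_ultralimit C'_monster C'_bigger c_enum UU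
  (fun l => aut_type j c (sigma' l)).
(* [s \o a 0] gives positions where [c] lists [a 0]; at these, [tau k \o c] takes the value
   [a k]. *)
pose E (b' : 'I_m -> C) := formula_map (sum_map (s \o a 0) b') phi.
have qE b' : tset q (E b') <-> U [set k | sat phi (with_params (a k) b')].
  rewrite Hq; suff -> : [set k | tset (aut_type j c (tau k)) (E b')] =
      [set k | sat phi (with_params (a k) b')] by [].
  apply: eq_set => k; apply/propext; rewrite aut_typeP sat_sum_map.
  by split; apply: sat_congr => -[i|i] //=; rewrite csE Htau.
have op_aut (f : automorphism C) b' : (forall i, f (b' i) = b 0 i) ->
    tset (op (aut_type j c f) q) (E (b 0)) <-> tset q (E b').
  move=> fb; have [g fK gK] := aut_bij f.
  rewrite op_ext (aut_actP _ _ fK gK) /subst_params /E formula_map_comp.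
  rewrite (_ : sum_map id g \o _ = sum_map (s \o a 0) b')//.
  by apply: funext => -[i|i] //=; rewrite -fb fK.
have nbhd := fun A H =>
  (nbhs_type_space p _).1 (op_cont q p A ((nbhs_type_space _ A).2 H)).
have [opE|nopE] := pselect (tset (op p q) (E (b 0))).
  (* Some [sigma' l] near [p] would put [phi(x, b l)] in [q], although [phi(a k, b l)] fails for all
     [k >= l]. *)
  have [|chi /Hp/filter_ex[l Hl] chiE] := nbhd (basic_clopen (E (b 0))).
    by exists (E (b 0)).
  have /qE : tset q (E (b l)).
    apply/(op_aut (sigma' l)); last exact: (chiE _ Hl).
    by move=> i; rewrite -Hsigma (Hsigma' l).1.
  apply/(ultra_not UU)/evU; exists l => // k lk; rewrite /= OP.
  by apply/negP; rewrite -leqNgt.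
(* The negation would persist near [p], yet some [rho] there has all [phi(a k, b')] true with [rho]
   mapping [b'] to [b 0]. *)
have [|chi /Hp Uchi chinE] := nbhd (basic_clopen (Fnot (E (b 0)))).
  by exists (Fnot (E (b 0))) => //; apply/type_not.
have [|rho [b' [rho_b' phib' rho_chi]]] :=
    automorphism_past_sequence C_monster UU evU (c := c) (chi := chi) OP Hsigma.
  apply: filterS Uchi => l /= /aut_typeP Hl.
  apply/(sat_aut (sigma' l)); apply: sat_congr Hl => -[i|x] //=.
  by rewrite (Hsigma' l).1.
have /type_not := chinE (aut_type j c rho) ((aut_typeP _ _ _ _).2 rho_chi).
by apply; apply/(op_aut _ _ rho_b')/qE; apply: filterS filterT => k _; exact: phib'.
Qed.

(* C' is the bigger monster model in which the types over C are realized, and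
   the tuple c enumerates all the elements of C. *)
Theorem corollaryA7
  (L : language) (T : set (sentence L)) (T_complete : complete_theory T)
  (K : Type) (C : structure L) (C_models : models C T) (C_monster : monster K C)
  (K' : Type) (C' : structure L) (C'_monster : monster K' C')
  (C'_bigger : card_lt [set: C] [set: K']) (j : elementary_embedding C C')
  (I : Type) (c : I -> C) (c_enum : forall x : C, exists i : I, c i = x) :
  (exists op : type_space j c -> type_space j c -> type_space j c,
     [/\ associative op, left_continuous op & extends_aut_action op])
  <-> stable T.
Proof.
split=> [[op [_ op_cont op_ext]]|T_stable].
  exact: (semigroup_stable T_complete C_models C_monster C'_monster C'_bigger
    c_enum op_cont op_ext).
exact: (stable_semigroup C_models T_stable C'_monster C'_bigger j c_enum).
Qed.
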